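(* Let $(X,M_X)$ be a quasi-Borel space. The quasi-Borel space $(P(\mathbb{R}))^X$ of kernels is a quotient of the quasi-Borel space $P(\mathbb{R}^X)$ of random functions; that is, there is a surjection $q\colon P(\mathbb{R}^X)\to(P(\mathbb{R}))^X$ such that $M_{(P(\mathbb{R}))^X}=\{q\circ\alpha\mid\alpha\in M_{P(\mathbb{R}^X)}\}$.
   Context: A quasi-Borel space is a set $X$ together with a set $M_X$ of functions $\mathbb{R}\to X$ such that: (i) $\alpha\circ f\in M_X$ whenever $\alpha\in M_X$ and $f\colon\mathbb{R}\to\mathbb{R}$ is (Borel) measurable; (ii) every constant function $\mathbb{R}\to X$ is in $M_X$; (iii) if $\mathbb{R}=\biguplus_{i\in\mathbb{N}}S_i$ with each $S_i$ Borel and $\alpha_i\in M_X$ for each $i$, then $\beta\in M_X$, where $\beta(r)=\alpha_i(r)$ for $r\in S_i$. A morphism $(X,M_X)\to(Y,M_Y)$ is a function $f\colon X\to Y$ with $f\circ\alpha\in M_Y$ for all $\alpha\in M_X$. $\mathbb{R}$ is a quasi-Borel space with $M_{\mathbb{R}}$ the set of measurable functions $\mathbb{R}\to\mathbb{R}$. Products are product sets with $M_{X\times Y}=\{f\mid\pi_1\circ f\in M_X,\ \pi_2\circ f\in M_Y\}$. The function space $Y^X$ is the set of morphisms $X\to Y$ with $M_{Y^X}=\{\alpha\colon\mathbb{R}\to Y^X\mid(r,x)\mapsto\alpha(r)(x)\text{ is a morphism }\mathbb{R}\times X\to Y\}$. $\Sigma_{M_X}=\{U\subseteq X\mid\forall\alpha\in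 M_X.\ \alpha^{-1}(U)\text{ is Borel}\}$, a $\sigma$-algebra on $X$. $G(\mathbb{R})$ is the set of Borel probability measures on $\mathbb{R}$ with the $\sigma$-algebra generated by the sets $\{\mu\mid\mu(U)<r\}$ for $U$ Borel and $r\in[0,1]$. A probability measure on $(X,M_X)$ is a pair $(\alpha,\mu)$ with $\alpha\in M_X$ and $\mu\in G(\mathbb{R})$. Write $(\alpha,\mu)\sim(\alpha',\mu')$ if the push-forwards satisfy $\alpha_*\mu=\alpha'_*\mu'$ as measures on $(X,\Sigma_{M_X})$, and $[\alpha,\mu]$ for the equivalence class. $P(X)$ is the quasi-Borel space of probability measures on $(X,M_X)$ modulo $\sim$, with $M_{P(X)}$ the set of $\beta\colon\mathbb{R}\to P(X)$ for which there exist $\alpha\in M_X$ and a measurable $g\colon\mathbb{R}\to G(\mathbb{R})$ with $\beta(r)=[\alpha,g(r)]$ for all $r\in\mathbb{R}$. *)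

(* Defs.v *)
From HB Require Import structures.
From mathcomp Require Import all_boot all_order all_algebra generic_quotient.
From mathcomp Require Import all_classical all_reals all_analysis.
From mathcomp Require Import measurable_realfun.

Set Implicit Arguments.
Unset Strict Implicit.
Unset Printing Implicit Defensive.

Import Order.TTheory GRing.Theory Num.Theory.

Local Open Scope classical_set_scope.
Local Open Scope ring_scope.

Record quasiBorelType (R : realType) := QuasiBorel {
  qbs_sort :> Type ;
  qbs_M : set (R -> qbs_sort) ;
  qbs_comp : forall (a : R -> qbs_sort) (f : R -> R),
    qbs_M a -> measurable_fun [set: R] f -> qbs_M (a \o f) ;
  qbs_cst : forall x : qbs_sort, qbs_M (fun=> x) ;
  qbs_glue : forall (S : nat -> set R) (a : nat -> R -> qbs_sort)
      (b : R -> qbs_sort),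
    (forall i, measurable (S i)) -> trivIset [set: nat] S ->
    \bigcup_i S i = [set: R] -> (forall i, qbs_M (a i)) ->
    (forall i r, S i r -> b r = a i r) -> qbs_M b
}.
Arguments qbs_M {R} _ _.

Definition qbs_morphism (R : realType) (X Y : quasiBorelType R) (f : X -> Y) :=
  forall a : R -> X, qbs_M X a -> qbs_M Y (f \o a).

Record qbs_hom (R : realType) (X Y : quasiBorelType R) := QbsHom {
  qbs_fun :> X -> Y ;
  qbs_funP : qbs_morphism qbs_fun
}.

Section real_line.
Variable R : realType.

Let M : set (R -> R) := [set f | measurable_fun [set: R] f].

Let M_comp (a f : R -> R) : M a -> measurable_fun [set: R] f -> M (a \o f).
Proof. by move=> Ma mf; exact: measurableT_comp. Qed.

Let M_cst (x : R) : M (fun=> x).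
Proof. exact: measurable_cst. Qed.

Let M_glue (S : nat -> set R) (a : nat -> R -> R) (b : R -> R) :
  (forall i, measurable (S i)) -> trivIset [set: nat] S ->
  \bigcup_i S i = [set: R] -> (forall i, M (a i)) ->
  (forall i r, S i r -> b r = a i r) -> M b.
Proof.
move=> mS _ covS Ma ba _ B mB.
rewrite setTI (_ : b @^-1` B = \bigcup_i (S i `&` a i @^-1` B)).
  apply: bigcupT_measurable => i; apply: measurableI => //.
  by rewrite -[X in measurable X]setTI; exact: Ma.
apply/seteqP; split=> [r Br|r [i _ [Sir aB]]] /=; last by rewrite (ba i).
have [i _ Sir] : (\bigcup_i S i) r by rewrite covS.
by exists i => //; split=> //=; rewrite -ba.
Qed.

Definition qbs_real : quasiBorelType R := QuasiBorel M_comp M_cst M_glue.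

End real_line.

Section product.
Variables (R : realType) (X Y : quasiBorelType R).

Let M : set (R -> X * Y) :=
  [set f | qbs_M X (fst \o f) /\ qbs_M Y (snd \o f)].

Let M_comp (a : R -> X * Y) (f : R -> R) :
  M a -> measurable_fun [set: R] f -> M (a \o f).
Proof.
by move=> [M1 M2] mf; split; [exact: qbs_comp M1 mf|exact: qbs_comp M2 mf].
Qed.

Let M_cst (x : X * Y) : M (fun=> x).
Proof. by split; exact: qbs_cst. Qed.

Let M_glue (S : nat -> set R) (a : nat -> R -> X * Y) (b : R -> X * Y) :
  (forall i, measurable (S i)) -> trivIset [set: nat] S ->
  \bigcup_i S i = [set: R] -> (forall i, M (a i)) ->
  (forall i r, S i r -> b r = a i r) -> M b.
Proof.
move=> mS tS covS Ma ba; split.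
  by apply: (qbs_glue mS tS covS (fun i => (Ma i).1)) => i r /ba /= ->.
by apply: (qbs_glue mS tS covS (fun i => (Ma i).2)) => i r /ba /= ->.
Qed.

Definition qbs_prod : quasiBorelType R := QuasiBorel M_comp M_cst M_glue.

End product.

Section function_space.
Variables (R : realType) (X Y : quasiBorelType R).

Let M : set (R -> qbs_hom X Y) :=
  [set a | @qbs_morphism R (qbs_prod (qbs_real R) X) Y (fun p => a p.1 p.2)].

Let M_comp (a : R -> qbs_hom X Y) (f : R -> R) :
  M a -> measurable_fun [set: R] f -> M (a \o f).
Proof.
move=> Ma mf c [c1 c2].
apply: (Ma (fun r => (f (c r).1, (c r).2))); split=> //.
exact: (measurableT_comp mf c1).
Qed.

Let M_cst (h : qbs_hom X Y) : M (fun=> h).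
Proof. by move=> c [_ c2]; exact: (qbs_funP h c2). Qed.

Let M_glue (S : nat -> set R) (a : nat -> R -> qbs_hom X Y)
    (b : R -> qbs_hom X Y) :
  (forall i, measurable (S i)) -> trivIset [set: nat] S ->
  \bigcup_i S i = [set: R] -> (forall i, M (a i)) ->
  (forall i r, S i r -> b r = a i r) -> M b.
Proof.
move=> mS tS covS Ma ba c Mc; have [c1 c2] := Mc.
apply: (@qbs_glue _ Y (fun i => (fst \o c) @^-1` S i)
  (fun i r => a i (c r).1 (c r).2)).
- by move=> i; rewrite -[X in measurable X]setTI; exact: c1.
- apply/trivIsetP => i j _ _ ij; rewrite -preimage_setI.
  by move/trivIsetP : tS => ->//; rewrite preimage_set0.
- by rewrite -preimage_bigcup covS preimage_setT.
- by move=> i; exact: (Ma i c Mc).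
- by move=> i r /ba /= ->.
Qed.

Definition qbs_exp : quasiBorelType R := QuasiBorel M_comp M_cst M_glue.

End function_space.

Section embeddings.
Variable R : realType.

(* [real_enc n] is a measurable embedding of R in ]n, n + 1[, with measurable
   left inverse [real_dec n]; the cells truncn @^-1` [set n] partition R. *)
Definition real_enc (n : nat) (x : R) : R := n%:R + expR (- expR x).
Definition real_dec (n : nat) (y : R) : R := ln (- ln (y - n%:R)).

Lemma real_encK n : cancel (real_enc n) (real_dec n).
Proof.
by move=> x; rewrite /real_enc /real_dec addrC addKr expRK opprK expRK.
Qed.

Lemma truncn_real_enc n x : Num.truncn (real_enc n x) = n.
Proof.
apply: truncn_def; rewrite /real_enc lerDl expR_ge0 /= -natr1 ltrD2l.
by rewrite expR_lt1 oppr_lt0 expR_gt0.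
Qed.

Lemma measurable_real_enc n : measurable_fun [set: R] (real_enc n).
Proof.
apply: measurable_funD => //.
apply: (measurableT_comp (@measurable_expR R)).
exact: (measurableT_comp (@oppr_measurable R _) (@measurable_expR R)).
Qed.

HB.instance Definition _ n :=
  isMeasurableFun.Build _ _ R R (real_enc n) (measurable_real_enc n).

Lemma measurable_real_dec n : measurable_fun [set: R] (real_dec n).
Proof.
apply: (measurableT_comp (@measurable_ln R)).
apply: (measurableT_comp (@oppr_measurable R _)).
apply: (measurableT_comp (@measurable_ln R)).
exact: measurable_funB.
Qed.

Lemma measurable_truncn_fiber (n : nat) :
  measurable (@Num.truncn R @^-1` [set n]).
Proof.
have le_itv k :
    @Num.truncn R @^-1` [set m | (m <= k)%N] = `]-oo, k.+1%:R[%classic.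
  by apply/seteqP; split=> x /=; rewrite in_itv /= truncn_le_nat.
case: n => [|n].
  rewrite (_ : [set 0%N] = [set m | (m <= 0)%N]); first by rewrite le_itv.
  by apply/seteqP; split=> m /=; [move->|rewrite leqn0 => /eqP].
rewrite (_ : _ @^-1` _ = `]-oo, n.+2%:R[%classic `\` `]-oo, n.+1%:R[%classic).
  by apply: measurableD; exact: measurable_itv.
rewrite -!le_itv; apply/seteqP; split=> x /=; first by move->; rewrite ltnn.
by move=> [xn /negP]; rewrite -ltnNge => nx; apply/eqP; rewrite eqn_leq xn.
Qed.

End embeddings.

(* The sigma-algebra Sigma_(M_X). *)
Definition qbs_measurable (R : realType) (X : quasiBorelType R) :
    set (set X) :=
  [set U | forall a : R -> X, qbs_M X a -> measurable (a @^-1` U)].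

(* A pair (alpha, mu) of a random element and a law. [pprobability R R] is G(R):
   its sigma-algebra is generated by the sets {mu | mu U < r} for U Borel and r
   in [0, 1]. Its elements are set functions on all subsets of R, so it may
   distinguish laws that agree on Borel sets; the quotient below identifies
   them. *)
Record qbs_measure (R : realType) (X : quasiBorelType R) := QbsMeasure {
  qbs_rv : R -> X ;
  qbs_law : pprobability R R ;
  qbs_rvM : qbs_M X qbs_rv
}.
Arguments QbsMeasure {R X} _ _ _.

HB.instance Definition _ (R : realType) (X : quasiBorelType R) :=
  gen_eqMixin (qbs_measure X).
HB.instance Definition _ (R : realType) (X : quasiBorelType R) :=
  gen_choiceMixin (qbs_measure X).

Section probability_space.
Variables (R : realType) (X : quasiBorelType R).

(* The two push-forwards agree on (X, Sigma_(M_X)). They are spelled out because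
   [pushforward] requires a pointed codomain, and X may be empty. *)
Definition qbs_measure_eq (p q : qbs_measure X) : Prop :=
  forall U, qbs_measurable U ->
    (qbs_law p : probability R R) (qbs_rv p @^-1` U) =
    (qbs_law q : probability R R) (qbs_rv q @^-1` U).

Definition qbs_measure_eqb : rel (qbs_measure X) :=
  fun p q => `[< qbs_measure_eq p q >].

Let eqb_refl : reflexive qbs_measure_eqb.
Proof. by move=> p; apply/asboolP. Qed.

Let eqb_sym : symmetric qbs_measure_eqb.
Proof.
by move=> p q; apply/idP/idP => /asboolP pq; apply/asboolP => U mU; rewrite pq.
Qed.

Let eqb_trans : transitive qbs_measure_eqb.
Proof.
move=> q p r /asboolP pq /asboolP qr.
by apply/asboolP => U mU; rewrite pq// qr.
Qed.

Canonical qbs_measure_equiv :=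
  EquivRel qbs_measure_eqb eqb_refl eqb_sym eqb_trans.

Definition qbs_prob_sort : Type := {eq_quot qbs_measure_equiv}%qT.

(* The equivalence class [alpha, mu]. *)
Definition qbs_class (a : R -> X) (Ma : qbs_M X a) (mu : pprobability R R) :
    qbs_prob_sort :=
  (\pi_({eq_quot qbs_measure_equiv}) (QbsMeasure a mu Ma))%qT.

Lemma qbs_classP (a b : R -> X) (Ma : qbs_M X a) (Mb : qbs_M X b)
    (mu nu : pprobability R R) :
  qbs_class Ma mu = qbs_class Mb nu <->
  qbs_measure_eq (QbsMeasure a mu Ma) (QbsMeasure b nu Mb).
Proof.
rewrite /qbs_class; split=> [/eqquotP/asboolP//|pq].
by apply/eqquotP/asboolP.
Qed.

Lemma qbs_class_surj (p : qbs_prob_sort) :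
  exists a (Ma : qbs_M X a) mu, p = qbs_class Ma mu.
Proof.
by elim/quotW: p => -[a mu Ma]; exists a, Ma, mu.
Qed.

Let M : set (R -> qbs_prob_sort) :=
  [set b | exists (a : R -> X) (Ma : qbs_M X a) (g : R -> pprobability R R),
     measurable_fun [set: R] g /\ forall r, b r = qbs_class Ma (g r)].

Let M_comp (b : R -> qbs_prob_sort) (f : R -> R) :
  M b -> measurable_fun [set: R] f -> M (b \o f).
Proof.
move=> [a [Ma [g [mg bE]]]] mf; exists a, Ma, (g \o f); split.
  exact: measurableT_comp.
by move=> r /=.
Qed.

Let M_cst (p : qbs_prob_sort) : M (fun=> p).
Proof.
have [a [Ma [mu ->]]] := qbs_class_surj p.
by exists a, Ma, (fun=> mu); split=> //; exact: measurable_cst.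
Qed.

Let M_glue (S : nat -> set R) (a : nat -> R -> qbs_prob_sort)
    (b : R -> qbs_prob_sort) :
  (forall i, measurable (S i)) -> trivIset [set: nat] S ->
  \bigcup_i S i = [set: R] -> (forall i, M (a i)) ->
  (forall i r, S i r -> b r = a i r) -> M b.
Proof.
move=> mS tS covS Ma ba.
have [c Pc] := choice Ma.
have Mc i : qbs_M X (c i) by have [] := Pc i.
have /choice[g /all_and2[mg aE]] i : exists gi : R -> pprobability R R,
    measurable_fun [set: R] gi /\ forall r, a i r = qbs_class (Mc i) (gi r).
  have [Mci [gi gP]] := Pc i.
  by exists gi; rewrite (Prop_irrelevance (Mc i) Mci).
have idxP r : exists i, S i r.
  by have [i _ Sir] : (\bigcup_i S i) r by [rewrite covS]; exists i.
have [idx Sidx] := choice idxP.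
have idxE i r : S i r -> idx r = i.
  by move=> Sir; apply: (tS (idx r) i I I); exists r.
pose d r := c (Num.truncn r) (real_dec (Num.truncn r) r).
have Md : qbs_M X d.
  apply: (@qbs_glue _ X (fun n => @Num.truncn R @^-1` [set n])
    (fun n => c n \o real_dec n)) => //.
  - exact: measurable_truncn_fiber.
  - apply/trivIsetP => i j _ _ /eqP ij.
    by apply/seteqP; split=> x // [/= -> /ij].
  - by apply/seteqP; split=> x //= _; exists (Num.truncn x).
  - by move=> i; apply: qbs_comp => //; exact: measurable_real_dec.
  - by move=> i r /= <-.
have dE i x : d (real_enc i x) = c i x by rewrite /d truncn_real_enc real_encK.
pose push i (mu : probability R R) : pprobability R R :=
  distribution mu (real_enc i).
exists d, Md, (fun r => push (idx r) (g (idx r) r)); split.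
  apply: (measurability (@pset _ R R : set (set (pprobability R R)))) => //.
  move=> _ [_ [t t01 [U mU <-]] <-]; rewrite setTI.
  have -> : (fun r => push (idx r) (g (idx r) r)) @^-1` mset U t =
      \bigcup_i (S i `&` g i @^-1` mset (real_enc i @^-1` U) t).
    apply/seteqP; split=> [r rU|r [i _ [Sir]]]; first by exists (idx r).
    by rewrite /preimage /= /mset /= (idxE _ _ Sir).
  apply: bigcupT_measurable => i; apply: measurableI => //.
  rewrite -[X in measurable X]setTI; apply: mg => //.
  apply: sub_sigma_algebra; exists t => //; exists (real_enc i @^-1` U) => //.
  by rewrite -[X in measurable X]setTI; exact: measurable_real_enc.
move=> r; rewrite (ba _ _ (Sidx r)) aE; apply/qbs_classP => U mU /=.
rewrite /distribution /pushforward; congr (_ _).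
by apply/seteqP; split=> x /=; rewrite dE.
Qed.

Definition qbs_prob : quasiBorelType R := QuasiBorel M_comp M_cst M_glue.

End probability_space.

(* Main.v *)
Require Import Defs.
From mathcomp Require Import all_boot all_order all_algebra.
From mathcomp Require Import all_classical all_reals all_analysis.
From mathcomp Require Import measurable_realfun lra.

(* The map q sends [alpha, mu] to the kernel x |-> [s |-> alpha s x, mu].
   It is a morphism because a function on R * R which is measurable along every
   measurable curve R -> R * R is measurable: R * R is a measurable retract of
   R, by interleaving binary digits.
   Conversely, let r |-> K r be a random element of kernels. A real law nu is
   the image of the uniform law on ]0, 1[ under its quantile function, which
   depends measurably on nu. So, if s codes the pair (r, u), the random function
   alpha s x := quantile (K r x) u together with the law g r of the code of
   (r, u), for u uniform, satisfies q [alpha, g r] = K r for all r, with alpha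
   independent of r. Surjectivity is the case of a constant K. *)

Set Implicit Arguments.
Unset Strict Implicit.
Unset Printing Implicit Defensive.

Import Order.TTheory GRing.Theory Num.Theory.
Import numFieldNormedType.Exports.

Local Open Scope classical_set_scope.
Local Open Scope ring_scope.

(** * Digit expansions, and R * R as a measurable retract of R *)

Section digits.
Variable R : realType.
Implicit Types (c x : R) (b : nat -> bool) (n : nat).

Definition shift b : nat -> bool := fun n => b n.+1.

Fixpoint partial_expansion c n b : R :=
  if n is m.+1 then (1 - c) * (b 0)%:R + c * partial_expansion c m (shift b)
  else 0.

(* [expansion c b] is the sum of the (1 - c) c^n b_n: the binary expansion for
   c = 1/2, a Cantor-type sum for c < 1/2. The latter never takes a value in
   ]c, 1 - c[, so that all digits can be read off it by comparison with 1/2. *)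
Definition expansion c b : R := limn (fun n => partial_expansion c n b).

Definition digit_step c x : R := (x - (1 - c) * (2^-1 <= x)%R%:R) / c.

Definition digit c x n : bool := 2^-1 <= iter n (digit_step c) x.

Lemma partial_expansion_itv c n b :
  0 <= c <= 1 -> 0 <= partial_expansion c n b <= 1.
Proof.
move=> c01; elim: n b => [|n IH] b /=; first by rewrite lexx ler01.
have := IH (shift b); case: (b 0%N) => /=; nra.
Qed.

Lemma partial_expansion_nd c b : 0 <= c <= 1 ->
  nondecreasing_seq (fun n => partial_expansion c n b).
Proof.
move=> c01; apply/nondecreasing_seqP => n; elim: n b => [|n IH] b.
  by have /andP[] := partial_expansion_itv 1 b c01.
by rewrite [leLHS]/= [leRHS]/= lerD2l ler_wpM2l //; case/andP: c01.
Qed.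

Lemma expansion_cvg c b : 0 <= c <= 1 ->
  (fun n => partial_expansion c n b) @ \oo --> expansion c b.
Proof.
move=> c01; apply: nondecreasing_is_cvgn; first exact: partial_expansion_nd.
by exists 1 => _ [n _ <-]; case/andP: (partial_expansion_itv n b c01).
Qed.

Lemma expansion_itv c b : 0 <= c <= 1 -> 0 <= expansion c b <= 1.
Proof.
move=> c01; have cvgb := @expansion_cvg c b c01; apply/andP; split.
  apply: (limr_ge (cvgP _ cvgb)); apply: nearW => n.
  by case/andP: (partial_expansion_itv n b c01).
apply: (limr_le (cvgP _ cvgb)); apply: nearW => n.
by case/andP: (partial_expansion_itv n b c01).
Qed.

Lemma expansionS c b : 0 <= c <= 1 ->
  expansion c b = (1 - c) * (b 0)%:R + c * expansion c (shift b).
Proof.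
move=> c01; have := @expansion_cvg c b c01.
rewrite -(cvg_shiftS (fun n => _)) => cvgb.
apply: (cvg_unique _ cvgb) => //=.
by apply: cvgD; [exact: cvg_cst|apply: cvgMl_tmp; exact: expansion_cvg].
Qed.

Lemma digit_expansion c b : 0 < c < 2^-1 -> digit c (expansion c b) = b.
Proof.
move=> c02; have c01 : 0 <= c <= 1 by lra.
(* A leading digit 0 puts the sum in [0, c], a leading digit 1 in [1 - c, 1]; since c < 1/2, the
   threshold 1/2 separates them. *)
have dig0 b' : (2^-1 <= expansion c b') = b' 0%N.
  rewrite expansionS //; have := expansion_itv (shift b') c01.
  by case: (b' 0%N) => /= e01; apply/idP/idP => //; nra.
have stepE b' : digit_step c (expansion c b') = expansion c (shift b').
  rewrite /digit_step dig0 expansionS // addrC addKr mulrC mulKf //.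
  by rewrite gt_eqF //; case/andP: c02.
apply/funext => n; rewrite /digit.
elim: n b => [|n IH] b; first exact: dig0.
by rewrite iterSr stepE IH.
Qed.

(** At c = 1/2 the digit step is x |-> 2x - [1/2 <= x], which maps [0, 1] to itself; hence each
    digit read halves the bound on the error. *)
Lemma expansion_digit x : 0 <= x <= 1 -> expansion 2^-1 (digit 2^-1 x) = x.
Proof.
move=> x01; have c01 : 0 <= (2^-1 : R) <= 1 by lra.
have err n y : 0 <= y <= 1 ->
    `|y - partial_expansion 2^-1 n (digit 2^-1 y)| <= 2^-1 ^+ n.
  elim: n y => [|n IH] y y01 /=; first by rewrite subr0 expr0 ger0_norm; lra.
  have -> : shift (digit 2^-1 y) = digit 2^-1 (digit_step 2^-1 y).
    by apply/funext => k; rewrite /shift /digit iterSr.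
  have step01 : 0 <= digit_step 2^-1 y <= 1.
    by rewrite /digit_step invrK; case: (lerP 2^-1 y) => /= ?; lra.
  have := IH _ step01; move: (partial_expansion _ _ _) => e.
  rewrite {1}/digit_step exprS /digit /= invrK !ler_norml.
  by move: (2^-1 ^+ n) => d; case: (lerP 2^-1 y) => /= ?; lra.
apply: (cvg_unique _ (@expansion_cvg _ _ c01)) => //=.
apply/cvgrPdist_le => e e0.
have := @cvg_expr R 2^-1; rewrite ger0_norm; last lra.
move=> /(_ ltac:(lra)) /cvgrPdist_le /(_ e e0).
apply: filterS => n; rewrite sub0r normrN ger0_norm ?exprn_ge0; try lra.
exact/le_trans/err.
Qed.

Lemma measurable_bool_natr :
  measurable_fun [set: bool] (fun t : bool => t%:R : R).
Proof. by []. Qed.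

Lemma measurable_expansion d (T : measurableType d) c (b : T -> nat -> bool) :
  0 <= c <= 1 -> (forall n, measurable_fun [set: T] (b ^~ n)) ->
  measurable_fun [set: T] (fun t => expansion c (b t)).
Proof.
move=> c01 mb.
apply: (@measurable_fun_cvg _ _ _ _ (fun n t => partial_expansion c n (b t))).
  move=> n; elim: n b mb => [|n IH] b mb /=; first exact: measurable_cst.
  apply: measurable_funD; apply: measurable_funM; try exact: measurable_cst.
    exact: (measurableT_comp measurable_bool_natr (mb 0%N)).
  by apply: (IH (fun t => shift (b t))) => m; exact: mb.
by move=> t _; exact: expansion_cvg.
Qed.

Lemma measurable_digit c n : measurable_fun [set: R] (digit c ^~ n).
Proof.
apply: measurable_fun_ler; first exact: measurable_cst.
elim: n => [|n IH]; first exact: measurable_id.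
apply: (measurableT_comp _ IH).
apply: measurable_funM; last exact: measurable_cst.
apply: measurable_funB; first exact: measurable_id.
apply: measurable_funM; first exact: measurable_cst.
apply: (measurableT_comp measurable_bool_natr).
by apply: measurable_fun_ler; [exact: measurable_cst|exact: measurable_id].
Qed.

Definition interleave b b' : nat -> bool :=
  fun n => if odd n then b' n./2 else b n./2.

(** Digits are read in base 2 but recombined with ratio 1/3: at ratio 1/2 distinct digit sequences
    may have the same sum, and the interleaved digits could not be recovered. *)
Definition real_pair (xy : R * R) : R :=
  expansion 3^-1 (interleave (digit 2^-1 (real_enc 0 xy.1))
                             (digit 2^-1 (real_enc 0 xy.2))).

Definition real_unpair (z : R) : R * R :=
  (real_dec 0 (expansion 2^-1 (fun n => digit 3^-1 z n.*2)),
   real_dec 0 (expansion 2^-1 (fun n => digit 3^-1 z n.*2.+1))).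

Lemma real_enc0_itv x : 0 <= real_enc 0 x <= 1.
Proof.
by rewrite /real_enc add0r expR_ge0 /= expR_le1 oppr_le0 expR_ge0.
Qed.

Lemma real_pairK : cancel real_pair real_unpair.
Proof.
case=> x y; rewrite /real_unpair /real_pair digit_expansion; last lra.
congr (_, _).
  rewrite -[RHS](real_encK 0); congr real_dec.
  rewrite -[RHS](expansion_digit (real_enc0_itv x)).
  by congr expansion; apply/funext => n; rewrite /interleave odd_double doubleK.
rewrite -[RHS](real_encK 0); congr real_dec.
rewrite -[RHS](expansion_digit (real_enc0_itv y)).
congr expansion; apply/funext => n.
by rewrite /interleave /= odd_double /= uphalf_double.
Qed.

Lemma measurable_real_pair : measurable_fun [set: R * R] real_pair.
Proof.
apply: measurable_expansion; first lra.
move=> n; rewrite /interleave; case: (odd n).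
  apply: (measurableT_comp (@measurable_digit _ _)).
  exact: (measurableT_comp (@measurable_real_enc R 0) measurable_snd).
apply: (measurableT_comp (@measurable_digit _ _)).
exact: (measurableT_comp (@measurable_real_enc R 0) measurable_fst).
Qed.

Lemma measurable_real_unpair : measurable_fun [set: R] real_unpair.
Proof.
apply: measurable_fun_pair;
  apply: (measurableT_comp (@measurable_real_dec R 0));
  apply: measurable_expansion; try lra; move=> n; exact: measurable_digit.
Qed.

End digits.

(** * Measurable families of laws *)

Lemma measurable_fun_pprobability d d' (T : measurableType d)
    (Y : measurableType d') (R : realType) (g : T -> pprobability Y R) :
  measurable_fun [set: T] g <->
  forall U, measurable U ->
    measurable_fun [set: T] (fun t => (g t : probability Y R) U).
Proof.
split=> [mg U mU|mg].
  exact: (measurable_kernel (kprobability mg) U mU).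
(* The generators are the preimages of half-lines under the evaluations at measurable sets. *)
apply: (measurability (@pset _ _ _ : set (set (pprobability Y R)))) => //.
move=> _ [_ [r r01 [U mU <-]] <-].
by apply: emeasurable_fun_infty_o => //; exact: mg.
Qed.

Definition image_law d d' (T : measurableType d) (Y : measurableType d')
    (R : realType) (f : T -> Y) (mf : measurable_fun [set: T] f)
    (mu : probability T R) : probability Y R :=
  distribution mu (mfun_Sub (mem_set mf)).

Lemma image_lawE d d' (T : measurableType d) (Y : measurableType d')
    (R : realType) (f : T -> Y) (mf : measurable_fun [set: T] f)
    (mu : probability T R) U :
  image_law mf mu U = mu (f @^-1` U).
Proof. by []. Qed.

(** * Quantile functions and the uniform law *)

Section quantile.
Variable R : realType.
Implicit Types (mu nu : probability R R) (u t : R).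

Definition quantile mu u : R :=
  inf [set t | (u%:E <= mu `]-oo, t]%classic)%E].

(** Galois connection between the quantile and distribution functions. The limits 0 and 1 of the
    latter make the set nonempty and bounded below; right continuity makes its infimum belong to
    it. *)
Lemma quantile_le mu u t : 0 < u < 1 ->
  (quantile mu u <= t) = (u%:E <= mu `]-oo, t]%classic)%E.
Proof.
move=> /andP[u0 u1].
pose idR : {RV mu >-> R} := mfun_Sub (mem_set (@measurable_id _ R setT)).
pose F := cdf idR.
have ltF s : (mu `]-oo, s]%classic < u%:E)%E = (fine (F s) < u).
  by rewrite -lte_fin fineK // fin_num_measure.
have leF s : (u%:E <= mu `]-oo, s]%classic)%E = (u <= fine (F s)).
  by rewrite -lee_fin fineK // fin_num_measure.
have Fy : fine (F s) @[s --> +oo] --> (1 : R) by exact/fine_cvg/cvg_cdfy1.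
have FNy : fine (F s) @[s --> -oo] --> (0 : R) by exact/fine_cvg/cvg_cdfNy0.
have Fr : fine (F s) @[s --> t^'+] --> fine (F t).
  apply: fine_cvg; rewrite fineK ?fin_num_measure //.
  exact: cdf_right_continuous.
set S := [set s | (u%:E <= mu `]-oo, s]%classic)%E].
have lbS s : fine (F s) < u -> lbound S s.
  rewrite -ltF => su r Sr; rewrite leNgt; apply/negP => rs.
  have : (mu `]-oo, r]%classic < u%:E)%E.
    apply: le_lt_trans su; apply: le_measure; rewrite ?inE //.
    by apply: subset_itvl; rewrite bnd_simp ltW.
  by rewrite ltNge; apply/negP/negPn.
have S0 : S !=set0.
  have [s us] := filter_ex (cvgr_gt _ Fy _ u1).
  by exists s; rewrite /S /= leF ltW.
have Slb : has_lbound S.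
  by have [s us] := filter_ex (cvgr_lt _ FNy _ u0); exists s; exact: lbS.
apply/idP/idP => [Qt|]; last by move=> St; exact: ge_inf.
rewrite leNgt; apply/negP; rewrite ltF => tu.
(* If F t < u, then F s < u for some s > t; such an s is a lower bound of [S], so the quantile
   exceeds t. *)
have near_t : \forall s \near t^'+, fine (F s) < u /\ t < s.
  near=> s; split; near: s; [exact: cvgr_lt Fr _ tu|exact: nbhs_right_gt].
have [s [Fs ts]] := @filter_ex _ _ (at_right_proper_filter t) _ near_t.
by have := lt_le_trans ts (lb_le_inf S0 (lbS _ Fs)); rewrite ltNge Qt.
Unshelve. all: by end_near.
Qed.

(* The library's uniform law lives on [measurableTypeR R], which has the same
   measurable sets as [R] but another display: hence the push-forward along the
   identity. *)
Let measurable_id_typeR :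
  measurable_fun [set: measurableTypeR R] (idfun : measurableTypeR R -> R).
Proof. exact: measurable_id. Qed.

Definition uniform01 : pprobability R R :=
  image_law measurable_id_typeR (uniform_prob (@ltr01 R)).

(** The guard restricts to the range of [quantile_le]; the default 0 is harmless, as [uniform01] has
    no mass outside ]0, 1[. *)
Definition sample mu u : R := if 0 < u < 1 then quantile mu u else 0.

(** The density lives on [0, 1]; removing the two endpoints, a null set, leaves the interval where
    [sample] is a quantile. *)
Lemma uniform01E U : measurable U ->
  (uniform01 : probability R R) U =
  lebesgue_measure (U `&` `]0%R, 1%R[%classic).
Proof.
move=> mU.
transitivity (lebesgue_measure (U `&` `[0%R, 1%R]%classic)).
  rewrite [LHS]integral_uniform_pdf.
  rewrite (eq_integral (fun=> 1%E)); last first.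
    move=> x; rewrite inE /= in_itv /= => -[_ x01].
    by rewrite /uniform_pdf x01 subr0 invr1.
  by rewrite integral_cst ?mul1e //; exact: measurableI.
have -> : `[0%R, 1%R]%classic = `]0%R, 1%R[%classic `|` [set 0; 1] :> set R.
  apply/seteqP; split=> x /=; rewrite !in_itv /=; first lra.
  by move=> [|[->|->]]; lra.
rewrite setIUr measureU0 //.
- exact: measurableI.
- apply: measurableI => //; apply: measurableU; exact: measurable_set1.
- apply: countable_lebesgue_measure0; apply: (@sub_countable _ _ _ [set 0; 1]).
    by apply: subset_card_le; exact: subIsetr.
  exact/finite_set_countable/finite_set2.
Qed.

End quantile.
Arguments uniform01 {R}.

(** By [quantile_le], the quantile exceeds x exactly when the mass of ]-oo, x] is less than u, a
    comparison of two measurable functions of the parameter. *)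
Lemma measurable_fun_sample d (T : measurableType d) (R : realType)
    (mu : T -> pprobability R R) (u : T -> R) :
  measurable_fun [set: T] mu -> measurable_fun [set: T] u ->
  measurable_fun [set: T] (fun t => sample (mu t) (u t)).
Proof.
move=> /measurable_fun_pprobability mmu um; rewrite /sample.
have mu01 : measurable_fun [set: T] (fun t => 0 < u t < 1).
  by apply: measurable_and; apply: measurable_fun_ltr.
apply: measurable_fun_if => //.
rewrite setTI => m01.
apply: (measurability _ (RGenOInfty.measurableE R)) => // _ [_ [x ->] <-].
have -> : (fun t => 0 < u t < 1) @^-1` [set true] `&`
    (fun t => quantile (mu t) (u t)) @^-1` `]x, +oo[%classic =
    (fun t => 0 < u t < 1) @^-1` [set true] `&`
    (fun t => (mu t : probability R R) `]-oo, x]%classic < (u t)%:E)%E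
      @^-1` [set true].
  apply/seteqP; split=> t /=; rewrite in_itv /= andbT => -[u01];
    by rewrite [(x < _)%R]ltNge quantile_le // -ltNge.
apply: measurableI => //; rewrite -[X in measurable X]setTI.
by apply: measurable_fun_lte => //; [exact: mmu|exact/measurable_EFinP].
Qed.

(** * Sampling a real law from the uniform law *)

Section sampling.
Variable R : realType.
Implicit Types (mu nu : probability R R).

Lemma measurable_sample mu : measurable_fun [set: R] (sample mu).
Proof.
by apply: (measurable_fun_sample (mu := fun=> mu)); [exact: measurable_cst|].
Qed.

(** The complementary rays ]x, +oo[ generate the Borel sets and are closed under intersection. *)
Lemma probability_ray_ext mu nu :
  (forall t, mu `]-oo, t]%classic = nu `]-oo, t]%classic) ->
  forall U, measurable U -> mu U = nu U.
Proof.
move=> munu U.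
apply: (@measure_unique _ R R (@RGenOInfty.G R)
  (fun n => `](- n%:R), +oo[%classic) _ _ _ _ mu nu).
- exact: RGenOInfty.measurableE.
- move=> _ _ [x ->] [y ->]; exists (Num.max x y).
  by apply/seteqP; split=> z /=; rewrite !in_itv /= !andbT gt_max; move=> /andP.
- by move=> n; exists (- n%:R).
- apply/seteqP; split=> // x _; exists (Num.truncn `|x|).+1 => //=.
  rewrite in_itv /= andbT ltrNl.
  by apply: le_lt_trans (truncnS_gt _); rewrite -normrN ler_norm.
- move=> _ [x ->]; rewrite -setCitvl.
  have mx : measurable (`]-oo, x]%classic : set R) by exact: measurable_itv.
  by rewrite [LHS](probability_setC mu mx) [RHS](probability_setC nu mx) munu.
- by move=> n; rewrite (le_lt_trans (probability_le1 _ _)) ?ltry.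
Qed.

(** On ]0, 1[ the sample is at most t exactly when u <= F, the mass of ]-oo, t]; this event has
    length F. *)
Lemma uniform01_sample mu U : measurable U ->
  (uniform01 : probability R R) (sample mu @^-1` U) = mu U.
Proof.
move=> mU.
suff rays t : image_law (measurable_sample mu) uniform01 `]-oo, t]%classic =
    mu `]-oo, t]%classic.
  exact: (probability_ray_ext rays mU).
rewrite [LHS]uniform01E; last first.
  by rewrite -[X in measurable X]setTI; exact: measurable_sample.
pose F := fine (mu `]-oo, t]%classic).
have mt : mu `]-oo, t]%classic = F%:E by rewrite fineK // fin_num_measure.
have F0 : 0 <= F by exact: fine_ge0.
have F1 : F <= 1 by rewrite -lee_fin -mt; exact: probability_le1.
rewrite [RHS]mt; move: F mt F0 F1 => F mt F0 F1.
(* The event is ]0, F] when F < 1, but ]0, 1[ when F = 1. *)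
have [F1'|F1'] := ltP F 1.
  rewrite (_ : _ `&` _ = `]0, F]%classic).
    rewrite lebesgue_measure_itv /= lte_fin sube0; case: ltP => // ?.
    by congr _%:E; lra.
  apply/seteqP; split=> u /=; rewrite !in_itv /= /sample.
    move=> [/[swap] u01]; rewrite u01 quantile_le // mt lee_fin; lra.
  move=> uF; have u01 : 0 < u < 1 by lra.
  by split => //; rewrite u01 quantile_le // mt lee_fin; lra.
rewrite (_ : _ `&` _ = `]0, 1[%classic).
  by rewrite lebesgue_measure_itv /= lte_fin ltr01 sube0; congr _%:E; lra.
apply/seteqP; split=> u /=; rewrite !in_itv /= /sample; first by case.
by move=> u01; split => //; rewrite u01 quantile_le // mt lee_fin; lra.
Qed.

End sampling.

(** [real_unpair] is itself such a curve, and f factors as (f \o [real_unpair]) \o [real_pair]. This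
    turns the curvewise conditions on random elements into joint measurability. *)
Lemma measurable_fun_real2 d (T : measurableType d) (R : realType)
    (f : R * R -> T) :
  (forall c : R -> R * R, measurable_fun [set: R] c ->
    measurable_fun [set: R] (f \o c)) ->
  measurable_fun [set: R * R] f.
Proof.
move=> mf; have -> : f = (f \o @real_unpair R) \o @real_pair R.
  by apply/funext => xy /=; rewrite real_pairK.
by apply: measurableT_comp (mf _ _) _;
  [exact: measurable_real_unpair|exact: measurable_real_pair].
Qed.

(** * Representatives of classes, and P(R) as the laws on R *)

Section representatives.
Variables (R : realType) (X : quasiBorelType R).

Lemma qbs_class_rep_ex (p : qbs_prob_sort X) :
  exists m : qbs_measure X, p = qbs_class (@qbs_rvM _ _ m) (qbs_law m).
Proof.
by have [a [Ma [mu ->]]] := qbs_class_surj p; exists (QbsMeasure a mu Ma).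
Qed.

Definition qbs_rep (p : qbs_prob_sort X) : qbs_measure X :=
  sval (cid (qbs_class_rep_ex p)).

Lemma qbs_repK (p : qbs_prob_sort X) :
  qbs_class (@qbs_rvM _ _ (qbs_rep p)) (qbs_law (qbs_rep p)) = p.
Proof. by rewrite /qbs_rep; case: cid. Qed.

Lemma qbs_rep_class (a : R -> X) (Ma : qbs_M X a) (mu : pprobability R R) U :
  qbs_measurable U ->
  (qbs_law (qbs_rep (qbs_class Ma mu)) : probability R R)
    (qbs_rv (qbs_rep (qbs_class Ma mu)) @^-1` U) =
  (mu : probability R R) (a @^-1` U).
Proof.
by move=> mU; have /qbs_classP/(_ _ mU) := qbs_repK (qbs_class Ma mu).
Qed.

End representatives.

Section real_law.
Variable R : realType.
Implicit Types p : qbs_prob (qbs_real R).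

Lemma qbs_measurable_real (U : set (qbs_real R)) :
  @qbs_measurable R (qbs_real R) U <-> measurable (U : set R).
Proof.
split=> [|mU a ma]; first by apply; exact: (@measurable_id _ R).
by rewrite -[X in measurable X]setTI; exact: ma.
Qed.

(** Only the values at Borel sets are independent of the chosen representative. *)
Definition real_law p : pprobability R R :=
  image_law (@qbs_rvM _ _ (qbs_rep p)) (qbs_law (qbs_rep p)).

Lemma real_law_class (a : R -> qbs_real R) (Ma : qbs_M (qbs_real R) a)
    (mu : pprobability R R) (U : set R) : measurable U ->
  (real_law (qbs_class Ma mu) : probability R R) U =
  (mu : probability R R) (a @^-1` U).
Proof. by move=> mU; apply: qbs_rep_class; exact/qbs_measurable_real. Qed.

Lemma real_law_ext p p' :
  (forall U, measurable U -> (real_law p : probability R R) U =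
                             (real_law p' : probability R R) U) ->
  p = p'.
Proof.
move=> pp'; rewrite -(qbs_repK p) -(qbs_repK p').
by apply/qbs_classP => U /qbs_measurable_real mU; exact: (pp' U mU).
Qed.

(** Forwards, the mass of U under b r is that of its preimage under the common random element.
    Backwards, the identity of R serves as common random element. *)
Lemma qbs_M_prob_real (b : R -> qbs_prob (qbs_real R)) :
  qbs_M (qbs_prob (qbs_real R)) b <->
  measurable_fun [set: R] (fun r => real_law (b r)).
Proof.
split=> [[a [Ma [g [mg bE]]]]|mb].
  apply/measurable_fun_pprobability => U mU.
  have -> : (fun r => (real_law (b r) : probability R R) U) =
      (fun r => (g r : probability R R) (a @^-1` U)).
    by apply/funext => r; rewrite bE real_law_class.
  move/measurable_fun_pprobability : mg; apply.
  by rewrite -[X in measurable X]setTI; exact: (Ma measurableT).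
exists idfun, (@measurable_id _ R [set: R]), (fun r => real_law (b r)).
by split=> // r; apply: real_law_ext => U mU; rewrite real_law_class.
Qed.

End real_law.

(** * The map q from random functions to kernels *)

Section evaluation.
Variables (R : realType) (X : quasiBorelType R).
Local Notation RX := (qbs_exp X (qbs_real R)).

Lemma qbs_M_eval (a : R -> RX) (x : X) :
  qbs_M RX a -> qbs_M (qbs_real R) (fun s => a s x).
Proof.
move=> Ma; apply: (Ma (fun s => (s, x))).
by split; [exact: (@measurable_id _ R)|exact: qbs_cst].
Qed.

Definition eval_law (p : qbs_prob RX) (x : X) : qbs_prob (qbs_real R) :=
  qbs_class (qbs_M_eval x (@qbs_rvM _ _ (qbs_rep p))) (qbs_law (qbs_rep p)).

(** The choice of representative is immaterial: evaluation at x is a morphism, so the set of h with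
    U (h x) is in Sigma_(M_X) for the function space. *)
Lemma real_law_eval (a : R -> RX) (Ma : qbs_M RX a) (mu : pprobability R R)
    (x : X) (U : set R) : measurable U ->
  (real_law (eval_law (qbs_class Ma mu) x) : probability R R) U =
  (mu : probability R R) [set s | U (a s x)].
Proof.
move=> mU; rewrite real_law_class //.
apply: (@qbs_rep_class _ RX a Ma mu [set h | U (h x)]) => a' Ma'.
by rewrite -[X in measurable X]setTI; exact: (qbs_M_eval x Ma').
Qed.

(** The mass of U is the g r-mass of the section at r of a Borel set of the plane. Varying law and
    point together serves both [eval_law_morphism] and [qbs_M_kernel_of]. *)
Lemma qbs_M_eval_law (a : R -> RX) (Ma : qbs_M RX a)
    (g : R -> pprobability R R) (c : R -> X) :
  measurable_fun [set: R] g -> qbs_M X c ->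
  qbs_M (qbs_prob (qbs_real R)) (fun r => eval_law (qbs_class Ma (g r)) (c r)).
Proof.
move=> mg Mc; apply/qbs_M_prob_real/measurable_fun_pprobability => U mU.
pose A := [set rs : R * R | U (a rs.2 (c rs.1))].
have mA : measurable A.
  rewrite -[A]setTI.
  apply: (@measurable_fun_real2 _ R R (fun rs => a rs.2 (c rs.1))) => // c' mc'.
  apply: (Ma (fun r => ((c' r).2, c (c' r).1))); split.
    exact: (measurableT_comp measurable_snd mc').
  exact: (qbs_comp Mc (measurableT_comp measurable_fst mc')).
rewrite (_ : (fun r => _) = (fun r => kprobability mg r (xsection A r))).
  by apply: measurable_fun_xsection_finite_kernel; rewrite inE.
by apply/funext => r; rewrite real_law_eval // xsectionE.
Qed.

Lemma eval_law_morphism (p : qbs_prob RX) : qbs_morphism (eval_law p).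
Proof.
move=> c Mc; rewrite -(qbs_repK p).
by apply: (qbs_M_eval_law (g := fun=> _) _ _ Mc); exact: measurable_cst.
Qed.

Definition kernel_of (p : qbs_prob RX) : qbs_exp X (qbs_prob (qbs_real R)) :=
  QbsHom (eval_law_morphism p).

End evaluation.

Lemma qbs_hom_ext (R : realType) (X Y : quasiBorelType R) (f g : qbs_hom X Y) :
  f =1 g -> f = g.
Proof.
case: f g => [f mf] [g mg] /= /funext fg; move: mf; rewrite fg => mf.
by rewrite (Prop_irrelevance mf mg).
Qed.

(** * Realizing a random kernel by one random function with varying laws *)

Section randomization.
Variables (R : realType) (X : quasiBorelType R).
Local Notation RX := (qbs_exp X (qbs_real R)).
Local Notation PRX := (qbs_exp X (qbs_prob (qbs_real R))).

Lemma qbs_M_kernel_of (b : R -> qbs_prob RX) :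
  qbs_M (qbs_prob RX) b -> qbs_M PRX (@kernel_of R X \o b).
Proof.
move=> [a [Ma [g [mg bE]]]].
suff kM (c : R -> R * X) : measurable_fun [set: R] (fst \o c) ->
    qbs_M X (snd \o c) ->
    qbs_M (qbs_prob (qbs_real R)) (fun r => kernel_of (b (c r).1) (c r).2).
  by move=> c [mc1 Mc2]; exact: kM.
move=> mc1 Mc2.
have -> : (fun r => kernel_of (b (c r).1) (c r).2) =
    (fun r => eval_law (qbs_class Ma (g (c r).1)) (c r).2).
  by apply/funext => r; rewrite bE.
exact: (qbs_M_eval_law Ma (measurableT_comp mg mc1) Mc2).
Qed.

Definition sample_kernel (K : R -> PRX) (s : R) (x : X) : qbs_real R :=
  sample (real_law (K (real_unpair s).1 x)) (real_unpair s).2.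

Lemma measurable_sample_kernel (K : R -> PRX) (t : R -> R) (c : R -> X) :
  qbs_M PRX K -> measurable_fun [set: R] t -> qbs_M X c ->
  measurable_fun [set: R] (fun r => sample_kernel K (t r) (c r)).
Proof.
move=> MK mt Mc.
have mu : measurable_fun [set: R] (fun r => real_unpair (t r)).
  exact: (measurableT_comp (@measurable_real_unpair R) mt).
apply: measurable_fun_sample; last exact: (measurableT_comp measurable_snd mu).
apply/qbs_M_prob_real; apply: (MK (fun r => ((real_unpair (t r)).1, c r))).
by split=> //; exact: (measurableT_comp measurable_fst mu).
Qed.

Lemma sample_kernel_morphism (K : R -> PRX) (MK : qbs_M PRX K) (s : R) :
  @qbs_morphism R X (qbs_real R) (sample_kernel K s).
Proof.
by move=> c Mc; apply: (measurable_sample_kernel (t := fun=> s)) => //;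
  exact: measurable_cst.
Qed.

Definition random_fun (K : R -> PRX) (MK : qbs_M PRX K) (s : R) : RX :=
  QbsHom (sample_kernel_morphism MK s).

Lemma qbs_M_random_fun (K : R -> PRX) (MK : qbs_M PRX K) :
  qbs_M RX (random_fun MK).
Proof. by move=> c [mc1 Mc2]; exact: measurable_sample_kernel. Qed.

Lemma measurable_real_pairr (r : R) :
  measurable_fun [set: R] (fun u => real_pair (r, u)).
Proof.
apply: (measurableT_comp (@measurable_real_pair R)).
exact: measurable_pair1.
Qed.

(** The product of the Dirac mass at r and the uniform law, carried to R by the code of pairs. *)
Definition seed (r : R) : pprobability R R :=
  image_law (measurable_real_pairr r) uniform01.

Lemma seedE (r : R) U :
  (seed r : probability R R) U =
  (uniform01 : probability R R) ((fun u => real_pair (r, u)) @^-1` U).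
Proof. exact: image_lawE. Qed.

Lemma measurable_seed : measurable_fun [set: R] seed.
Proof.
apply/measurable_fun_pprobability => U mU.
have mcst := @measurable_cst _ _ R (pprobability R R) setT uniform01.
rewrite (_ : (fun r => _) =
    (fun r => kprobability mcst r (xsection (@real_pair R @^-1` U) r))).
  apply: measurable_fun_xsection_finite_kernel; rewrite inE.
  by rewrite -[X in measurable X]setTI; exact: measurable_real_pair.
by apply/funext => r; rewrite xsectionE.
Qed.

(** Under [seed r] the first decoded coordinate is r and the second is uniform, so the value at x is
    a sample of the law K r x. *)
Lemma kernel_of_random_fun (K : R -> PRX) (MK : qbs_M PRX K) (r : R) :
  kernel_of (qbs_class (qbs_M_random_fun MK) (seed r)) = K r.
Proof.
apply: qbs_hom_ext => x; apply: real_law_ext => U mU.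
rewrite -[RHS](uniform01_sample (real_law (K r x)) mU).
apply: etrans (real_law_eval (qbs_M_random_fun MK) (seed r) x mU) _.
have E u : random_fun MK (real_pair (r, u)) x = sample (real_law (K r x)) u.
  by rewrite [LHS]/(sample_kernel K _ x) /sample_kernel real_pairK.
have -> : sample (real_law (K r x)) @^-1` U =
    (fun u => real_pair (r, u)) @^-1` [set s | U (random_fun MK s x)].
  by apply/seteqP; split=> u; rewrite /preimage /mkset E.
exact: seedE.
Qed.

End randomization.

Theorem theorem26 (R : realType) (X : quasiBorelType R) :
  exists q : qbs_prob (qbs_exp X (qbs_real R)) ->
             qbs_exp X (qbs_prob (qbs_real R)),
    set_surj [set: qbs_prob (qbs_exp X (qbs_real R))]
             [set: qbs_exp X (qbs_prob (qbs_real R))] q /\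
    qbs_M (qbs_exp X (qbs_prob (qbs_real R))) =
      [set q \o a | a in qbs_M (qbs_prob (qbs_exp X (qbs_real R)))].
Proof.
exists (@kernel_of R X); split.
  (* The kernel k is taken as a constant family; the index 0 of the seed is arbitrary. *)
  move=> k _; have Mk := qbs_cst k.
  exists (qbs_class (qbs_M_random_fun Mk) (seed 0)) => //.
  exact: kernel_of_random_fun.
apply/seteqP; split=> [K MK|_ [b Mb <-]]; last exact: qbs_M_kernel_of.
exists (fun r => qbs_class (qbs_M_random_fun MK) (seed r)).
  exists (random_fun MK), (qbs_M_random_fun MK), (@seed R).
  by split=> //; exact: measurable_seed.
by apply/funext => r; exact: kernel_of_random_fun.
Qed.
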